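(* Let $\Bbbk$ be a field and $n\ge3$. The following families of weighted Veronese rings are not Koszul: (1) $V_{(3,\,3k+1,\,3k+2,\,w_4,\ldots,w_n),\,3(3k+2)}$ for any integers $k\geq 1$ and $w_4,\ldots,w_n>3(3k+2)$; (2) $V_{(f+1,\,f+2,\,f^2+f-1,\,w_4,\ldots,w_n),\,3(f^2+f-1)}$ for any integers $f\geq 2$ and $w_4,\ldots,w_n>3(f^2+f-1)$.
   Context: For positive integers $w_1,\ldots,w_n,d$, $V_{(w_1,\ldots,w_n),d}=\bigoplus_{i\ge0}R_{di}$, where $R=\Bbbk[x_1,\ldots,x_n]$ is graded by $\deg x_i=w_i$. Let $\mathfrak m$ be the homogeneous maximal ideal of $V=V_{(w_1,\ldots,w_n),d}$. The ring $V$ is called Koszul if its associated graded ring $\operatorname{gr}_{\mathfrak m}V=\bigoplus_{i\ge0}\mathfrak m^i/\mathfrak m^{i+1}$ is a Koszul algebra in the usual sense, i.e. the residue field $\Bbbk$ has a linear free resolution over the standard graded $\Bbbk$-algebra $\operatorname{gr}_{\mathfrak m}V$. *)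

(* Defs.v *)
From HB Require Import structures.
From mathcomp Require Import all_boot all_order all_algebra.
From mathcomp.classical Require Import boolp.
From mathcomp Require Import mpoly.

Set Implicit Arguments.
Unset Strict Implicit.
Unset Printing Implicit Defensive.

Import GRing.Theory.
Local Open Scope ring_scope.

(* V_(w, d): the polynomials all of whose monomials have weighted degree      *)
(* divisible by d, as a subring of k[x_1, ..., x_n]; weights w_1, ..., w_n    *)
(* are numbered from 0 in the tuple w.                                        *)

Section WeightedVeronese.
Variables (K : fieldType) (n : nat) (w : n.-tuple nat) (d : nat).

Definition wdeg (m : 'X_{1..n}) : nat := (\sum_(i < n) m i * tnth w i)%N.

Lemma wdeg0 : wdeg 0%MM = 0%N.
Proof. by rewrite /wdeg big1 // => i _; rewrite mnm0E mul0n. Qed.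

Lemma wdegD m1 m2 : wdeg (m1 + m2)%MM = (wdeg m1 + wdeg m2)%N.
Proof.
by rewrite /wdeg -big_split; apply: eq_bigr => i _; rewrite mnmDE mulnDl.
Qed.

Definition veronese_pred : {pred {mpoly K[n]}} :=
  fun p => all (fun m => d %| wdeg m)%N (msupp p).

Lemma veronese_subring : subring_closed veronese_pred.
Proof.
split.
- by rewrite unfold_in msupp1 /= wdeg0 dvdn0.
- move=> p q /allP hp /allP hq; apply/allP => m /msuppB_le.
  by rewrite mem_cat => /orP[/hp|/hq].
- move=> p q /allP hp /allP hq.
  apply/allP => m /msuppM_le/allpairsP[[m1 m2] /= [h1 h2 ->]].
  by rewrite wdegD; apply: dvdn_add; [apply: hp | apply: hq].
Qed.

HB.instance Definition _ :=
  GRing.isSubringClosed.Build {mpoly K[n]} veronese_pred veronese_subring.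

Record veronese := Veronese {
  veronese_val :> {mpoly K[n]};
  _ : veronese_val \in veronese_pred }.

HB.instance Definition _ := [isSub for veronese_val].
HB.instance Definition _ := [Choice of veronese by <:].
HB.instance Definition _ := [SubChoice_isSubComNzRing of veronese by <:].

(* The homogeneous maximal ideal, i.e. the sum of the R_(di) with i > 0.      *)
Definition veronese_max : {pred veronese} :=
  fun p => all (fun m => 0 < wdeg m)%N (msupp (val p)).

Lemma veronese_max_ideal : idealr_closed veronese_max.
Proof.
split.
- by rewrite unfold_in rmorph0 msupp0.
- by rewrite unfold_in rmorph1 msupp1 /= wdeg0.
- move=> a p q /allP hp /allP hq; apply/allP => m.
  rewrite rmorphD rmorphM => /msuppD_le; rewrite mem_cat => /orP[|/hq //].
  move=> /msuppM_le/allpairsP[[m1 m2] /= [_ h2 ->]].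
  by rewrite wdegD; apply: ltn_addl; apply: hp.
Qed.

HB.instance Definition _ :=
  isIdealr.Build veronese veronese_max veronese_max_ideal.

End WeightedVeronese.

(* gr_m V, built as the quotient of the Rees algebra                          *)
(*   { p in V[t] | p_i in m^i for all i }                                     *)
(* by its ideal { p | p_i in m^(i+1) for all i }.                             *)

Section AssociatedGraded.
Variables (V : comNzRingType) (m : idealr V).

Fixpoint ideal_exp (i : nat) : V -> Prop :=
  if i is j.+1 then fun x => exists (r : nat) (a b : 'I_r -> V),
    [/\ forall l, a l \in m, forall l, ideal_exp j (b l)
      & x = \sum_(l < r) a l * b l]
  else fun _ => True.

Lemma ideal_exp0 i : ideal_exp i 0.
Proof.
case: i => [|i] //=; exists 0%N, (fun=> 0), (fun=> 0).
by split=> [[]|[]|] //; rewrite big_ord0.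
Qed.

Lemma ideal_expD i x y : ideal_exp i x -> ideal_exp i y -> ideal_exp i (x + y).
Proof.
case: i => [|i] //= [r [a [b [ha hb ->]]]] [s [a' [b' [ha' hb' ->]]]].
pose g T (f : 'I_r -> T) (f' : 'I_s -> T) l :=
  match split l with inl l => f l | inr l => f' l end.
exists (r + s)%N, (g _ a a'), (g _ b b'); split.
- by move=> l; rewrite /g; case: (split l).
- by move=> l; rewrite /g; case: (split l).
rewrite big_split_ord /=; congr (_ + _); apply: eq_bigr => l _; rewrite /g.
- by rewrite (unsplitK (inl l)).
- by rewrite (unsplitK (inr l)).
Qed.

Lemma ideal_expMl i c x : ideal_exp i x -> ideal_exp i (c * x).
Proof.
case: i => [|i] //= [r [a [b [ha hb ->]]]].
exists r, (fun l => c * a l), b; split=> // [l|].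
  exact: idealMr.
by rewrite mulr_sumr; apply: eq_bigr => l _; rewrite mulrA.
Qed.

Lemma ideal_expN i x : ideal_exp i x -> ideal_exp i (- x).
Proof. by rewrite -mulN1r; apply: ideal_expMl. Qed.

Lemma ideal_exp_sum i (I : Type) (r : seq I) (F : I -> V) :
  (forall k, ideal_exp i (F k)) -> ideal_exp i (\sum_(k <- r) F k).
Proof.
move=> hF; apply: big_ind => [|x y|k _]; [exact: ideal_exp0 | exact: ideal_expD |].
exact: hF.
Qed.

Lemma ideal_expM i j x y :
  ideal_exp i x -> ideal_exp j y -> ideal_exp (i + j) (x * y).
Proof.
elim: i x => [|i IHi] x hx hy; first exact: ideal_expMl.
case: hx => r [a [b [ha hb ->]]]; rewrite addSn.
exists r, a, (fun l => b l * y); split=> // [l|]; first exact: (IHi _ (hb l) hy).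
by rewrite mulr_suml; apply: eq_bigr => l _; rewrite mulrA.
Qed.

Lemma ideal_exp1 x : ideal_exp 1 x -> x \in m.
Proof.
case=> r [a [b [ha _ ->]]]; apply: rpred_sum => l _.
by rewrite mulrC; apply: idealMr.
Qed.

Definition rees_pred : {pred {poly V}} :=
  fun p => `[< forall i, ideal_exp i p`_i >].

Lemma rees_subring : subring_closed rees_pred.
Proof.
split.
- apply/asboolP => -[|i] //; rewrite coef1; exact: ideal_exp0.
- move=> p q /asboolP hp /asboolP hq; apply/asboolP => i.
  by rewrite coefB; apply/ideal_expD/ideal_expN.
- move=> p q /asboolP hp /asboolP hq; apply/asboolP => i.
  rewrite coefM; apply: ideal_exp_sum => j.
  by rewrite -{1}(subnKC (leq_ord j)); apply: ideal_expM.
Qed.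

HB.instance Definition _ :=
  GRing.isSubringClosed.Build {poly V} rees_pred rees_subring.

Record rees := Rees { rees_val :> {poly V}; _ : rees_val \in rees_pred }.

HB.instance Definition _ := [isSub for rees_val].
HB.instance Definition _ := [Choice of rees by <:].
HB.instance Definition _ := [SubChoice_isSubComNzRing of rees by <:].

Definition gr_ker : {pred rees} :=
  fun p => `[< forall i, ideal_exp i.+1 (val p)`_i >].

Lemma gr_ker_ideal : idealr_closed gr_ker.
Proof.
split.
- by apply/asboolP => i; rewrite rmorph0 coef0; apply: ideal_exp0.
- apply/negP => /asboolP /(_ 0%N); rewrite rmorph1 coef1 => /ideal_exp1.
  by rewrite idealr1.
- move=> a p q /asboolP hp /asboolP hq; apply/asboolP => i.
  rewrite rmorphD rmorphM coefD; apply: ideal_expD => //.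
  rewrite coefM; apply: ideal_exp_sum => j.
  have /asboolP ha := valP a.
  by rewrite -{1}(subnKC (leq_ord j)) -addnS; apply: ideal_expM.
Qed.

HB.instance Definition _ := isIdealr.Build rees gr_ker gr_ker_ideal.

Definition gr := {ideal_quot gr_ker}.

(* m^i / m^(i+1) inside gr. *)
Definition gr_comp (i : nat) (x : gr) : Prop :=
  exists (a : V) (p : rees), val p = a *: 'X^i /\ x = \pi_gr%qT p.

End AssociatedGraded.

(* A is a graded ring with components A_i = G i.  The residue field is        *)
(* A / A_+ (so A_0 is the base field), and a linear free resolution is an     *)
(* exact complex                                                              *)
(*   ... -> A(-2)^(b 2) -> A(-1)^(b 1) -> A(0)^(b 0) = A -> A / A_+ -> 0.     *)
(* Elements of A^b are row vectors; a degree-preserving map                   *)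
(* A(-i-1)^(b i.+1) -> A(-i)^(b i) is right multiplication by a matrix with   *)
(* entries in A_1.                                                            *)

Section Koszul.
Variables (A : comNzRingType) (G : nat -> A -> Prop).

Definition irrelevant (x : A) : Prop :=
  exists (r : nat) (f : 'I_r -> A),
    (forall i : 'I_r, G i.+1 (f i)) /\ x = \sum_(i < r) f i.

Definition linear_resolution (b : nat -> nat)
    (phi : forall i, 'M[A]_(b i.+1, b i)) : Prop :=
  [/\ b 0%N = 1%N,
      forall i s t, G 1%N (phi i s t),
      forall v : 'rV[A]_(b 0%N),
        (exists u, v = u *m phi 0%N) <-> (forall s, irrelevant (v 0 s))
    & forall i (v : 'rV[A]_(b i.+1)),
        (exists u, v = u *m phi i.+1) <-> v *m phi i = 0].

Definition koszul_algebra : Prop :=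
  exists (b : nat -> nat) (phi : forall i, 'M[A]_(b i.+1, b i)),
    linear_resolution phi.

End Koszul.

Definition koszul (V : comNzRingType) (m : idealr V) : Prop :=
  koszul_algebra (@gr_comp V m).

Definition veronese_koszul (K : fieldType) (n : nat) (w : n.-tuple nat)
    (d : nat) : Prop :=
  koszul (@veronese_max K n w d).

(* Main.v *)
(* In degree d the ring has monomials A, B, C, D with B^3 = ACD, while the only
   factorization of B^2 in V is B * B.  So B^3 - ACD is a minimal cubic relation
   of gr V, which a Koszul algebra cannot have.  Minimality is detected by the
   coefficients c_i of B^i in gr_i V (i <= 2), which satisfy the Leibniz rule,
   i.e. form a ring morphism gr V -> K[s]/(s^3): if phi_0 is the first map of a
   linear resolution, B = beta phi_0 and D = delta phi_0, the syzygy
   B^2 beta - AC delta of phi_0 is not in the image of a matrix of linear forms.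

   In both families A and C do not involve x_3, B involves it once and D = x_3^3. *)
From HB Require Import structures.
Require Import Defs.
From mathcomp Require Import all_boot all_order all_algebra.
From mathcomp Require Import boolp mpoly zify.

Set Implicit Arguments.
Unset Strict Implicit.
Unset Printing Implicit Defensive.

Import GRing.Theory.

(** * Obstruction to linear resolutions: a cubic relation seen by truncated coefficients *)

Section CubicRelation.
Local Open Scope ring_scope.
Variables (A : comNzRingType) (G : nat -> A -> Prop) (K : comNzRingType).
Variable c : nat -> {additive A -> K}.
Hypothesis cM : forall i x y, (i <= 2)%N ->
  c i (x * y) = \sum_(j < i.+1) c j x * c (i - j)%N y.
Hypothesis cG1 : forall x, G 1 x -> c 0 x = 0 /\ c 2 x = 0.

Let c1M x y : c 1 (x * y) = c 0 x * c 1 y + c 1 x * c 0 y.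
Proof. by rewrite cM // !big_ord_recl big_ord0 addr0. Qed.

Let c2M x y : c 2 (x * y) = c 0 x * c 2 y + (c 1 x * c 1 y + c 2 x * c 0 y).
Proof. by rewrite cM // !big_ord_recl big_ord0 addr0. Qed.

Lemma irrelevant_G1 x : G 1 x -> irrelevant G x.
Proof.
move=> Gx; exists 1%N, (fun=> x); split; last by rewrite big_ord1.
by move=> i; rewrite ord1.
Qed.

Lemma cubic_relation_not_koszul x y z t :
  G 1 x -> G 1 y -> G 1 z -> G 1 t ->
  y * y * y = x * z * t -> c 1 x = 0 -> c 1 y = 1 ->
  ~ koszul_algebra G.
Proof.
move=> Gx Gy Gz Gt rel c1x c1y [b [phi [b0 Gphi im0 im1]]].
have s0 : 'I_(b 0) by rewrite b0; exact: ord0.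
(* As [b 0 = 1], the constant row [const_mx u] is just the element [u], and the image of [phi 0] is
   the irrelevant ideal. *)
have lift u : G 1 u -> exists v, const_mx u = v *m phi 0 :> 'rV_(b 0).
  by move=> Gu; apply/(im0 (const_mx u)) => s; rewrite mxE; apply: irrelevant_G1.
have [beta Hbeta] := lift y Gy.
have [delta Hdelta] := lift t Gt.
(* [phi 0] sends this vector to [y * y * y - x * z * t = 0]; exactness lifts it along [phi 1]. *)
have [u Hu] : exists u, (y * y) *: beta - (x * z) *: delta = u *m phi 1.
  apply/im1; rewrite mulmxBl -!scalemxAl -Hbeta -Hdelta.
  by apply/matrixP => i j; rewrite !mxE rel subrr.
have phi10 : phi 1 *m phi 0 = 0.
  apply/row_matrixP => l; rewrite row_mul row0; apply/im1.
  by exists (delta_mx 0 l); rewrite -rowE.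
have [[c0x _] [c0y _] [c0z _]] := And3 (cG1 Gx) (cG1 Gy) (cG1 Gz).
(* Contracting with [c 1 (phi 0)] turns [c 2] of a linear syzygy [l] of [phi 0]
   into [c 2 (l *m phi 0) = 0]; hence this functional kills the image of [phi 1]. *)
have lhs : \sum_s c 2 (((y * y) *: beta - (x * z) *: delta) 0 s) * c 1 (phi 0 s s0)
    = 1.
  (* Among the coefficients of index at most 2 of [y * y] and [x * z], only [c 2 (y * y) = 1] is
     nonzero, so [c 2] of entry [s] is [c 0 (beta 0 s)]. Applying [c 1] to [y = beta *m phi 0] shows
     that the sum is [c 1 y]. *)
  have /matrixP/(_ 0 s0) := Hbeta; rewrite !mxE => /(congr1 (c 1)).
  rewrite c1y raddf_sum /= => ->; apply: eq_bigr => s _.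
  have [c0p _] := cG1 (Gphi 0%N s s0).
  rewrite c1M c0p mulr0 addr0 !mxE raddfB /= !c2M !c1M !cM // !big_ord1 /=.
  by rewrite subn0 c0y c0x c1x c1y c0z !(mul0r, mulr0, addr0, add0r, mul1r, subr0).
have rhs : \sum_s c 2 ((u *m phi 1) 0 s) * c 1 (phi 0 s s0) = 0.
  under eq_bigr => s _.
    rewrite !mxE raddf_sum mulr_suml /=.
    under eq_bigr => l _.
      have [c0p c2p] := cG1 (Gphi 1%N l s).
      rewrite c2M c0p c2p !mulr0 add0r addr0.
      over.
    over.
  rewrite exchange_big big1 // => l _ /=.
  under eq_bigr do rewrite -mulrA.
  rewrite -mulr_sumr.
  have /matrixP/(_ l s0) := phi10; rewrite !mxE => /(congr1 (c 2)).
  rewrite raddf_sum raddf0 /=; under eq_bigr => s _.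
    have [c0p c2p] := cG1 (Gphi 1%N l s).
    have [c0q c2q] := cG1 (Gphi 0%N s s0).
    rewrite c2M c0p c2p mul0r add0r mul0r addr0.
    over.
  by move=> ->; rewrite mulr0.
by have /eqP := rhs; rewrite -Hu lhs oner_eq0.
Qed.

End CubicRelation.

(** * Coefficients of the powers of a monomial, from polynomials to the associated graded ring *)

Lemma mcoeffM_unique n (R : nzRingType) (p q : {mpoly R[n]}) k1 k2 :
  (forall l1 l2, (l1 + l2 = k1 + k2)%MM -> (p@_l1 * q@_l2 != 0)%R -> l1 = k1) ->
  ((p * q)@_(k1 + k2)%MM = p@_k1 * q@_k2)%R.
Proof.
move=> uniq_k; rewrite mcoeffM.
have h1 : (mdeg k1 < (mdeg (k1 + k2)%MM).+1)%N by rewrite ltnS mdegD leq_addr.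
have h2 : (mdeg k2 < (mdeg (k1 + k2)%MM).+1)%N by rewrite ltnS mdegD leq_addl.
rewrite (bigD1 (BMultinom h1, BMultinom h2)) //= big1 ?addr0 // => -[l1 l2] /=.
case/andP=> /eqP e; apply: contraNeq => nz.
have e1 : l1 = k1 :> 'X_{1..n} by apply: uniq_k nz.
have e2 : l2 = k2 :> 'X_{1..n}.
  by apply: (@addmI _ k1); apply: etrans (esym e); congr (_ + _)%MM.
by rewrite xpair_eqE !bmeqP /= e1 e2 !eqxx.
Qed.

Section MonomialCoefficients.
Local Open Scope ring_scope.
Variables (K : fieldType) (n : nat) (w : n.-tuple nat) (d : nat).
Hypothesis w_gt0 : forall i, (0 < tnth w i)%N.
Let V := veronese K w d.
Let m := @veronese_max K n w d.

Definition vcoef k (p : V) : K := (val p)@_k.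

Lemma vcoef_is_zmod_morphism k : zmod_morphism (vcoef k).
Proof. by move=> p q; rewrite /vcoef rmorphB mcoeffB. Qed.

HB.instance Definition _ k :=
  GRing.isZmodMorphism.Build V K (vcoef k) (@vcoef_is_zmod_morphism k).

Lemma wdeg_eq0 k : wdeg w k = 0%N -> k = 0%MM.
Proof.
move/eqP; rewrite sum_nat_eq0 => /forallP h; apply/mnmP => i.
by have := h i; rewrite muln_eq0 (gtn_eqF (w_gt0 i)) orbF mnm0E => /eqP.
Qed.

Lemma wdegMn k i : wdeg w (k *+ i)%MM = (i * wdeg w k)%N.
Proof. by elim: i => [|i IH]; rewrite ?mulm0n ?wdeg0 // mulmS wdegD IH mulSn. Qed.

Lemma veronese_max_wdeg (p : V) k : p \in m -> vcoef k p != 0 -> (d <= wdeg w k)%N.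
Proof.
move=> /allP mp; rewrite /vcoef -mcoeff_msupp => pk.
by apply: dvdn_leq; [apply: mp | apply: (allP (valP p))].
Qed.

Lemma ideal_exp_wdeg i (p : V) k :
  ideal_exp m i p -> vcoef k p != 0 -> (i * d <= wdeg w k)%N.
Proof.
elim: i p k => [|i IH] p k //= [r [a [b [ma mb ->]]]] nz.
have [l] : exists l, vcoef k (a l * b l) != 0.
  apply/existsP; apply: contraNT nz => /existsPn h.
  by rewrite raddf_sum big1 //= => l _; apply/eqP; rewrite -[_ == _]negbK h.
rewrite /vcoef rmorphM /= -mcoeff_msupp => /msuppM_le/allpairsP[[k1 k2] /= [h1 h2 ->]].
rewrite wdegD mulSn leq_add //.
- by apply: (@veronese_max_wdeg (a l)); rewrite // /vcoef -mcoeff_msupp.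
- by apply: (IH (b l)); rewrite // /vcoef -mcoeff_msupp.
Qed.

Variable B : 'X_{1..n}.
Hypothesis d_gt0 : (0 < d)%N.
Hypothesis wB : wdeg w B = d.
Hypothesis B2 : forall k1 k2, (k1 + k2 = B + B)%MM -> wdeg w k1 = d ->
  wdeg w k2 = d -> k1 = B.

(** Monomials of m^i have weighted degree at least [i * d], so a product reaching degree
    [(i + j) * d] forces both factors to have minimal degree. If [i] or [j] is 0, the corresponding
    monomial is trivial; the case [i = j = 1] is [B2]. *)
Lemma mcoeffM_pow i j (p q : V) : (i + j <= 2)%N ->
  ideal_exp m i p -> ideal_exp m j q ->
  vcoef (B *+ (i + j)) (p * q) = vcoef (B *+ i) p * vcoef (B *+ j) q.
Proof.
move=> ij2 mp mq.
have factor k1 k2 : vcoef k1 p * vcoef k2 q != 0 ->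
    (k1 + k2 = B *+ (i + j))%MM -> k1 = (B *+ i)%MM.
  rewrite mulf_eq0 negb_or => /andP[/(ideal_exp_wdeg mp) h1 /(ideal_exp_wdeg mq) h2] e.
  have := congr1 (wdeg w) e; rewrite wdegD wdegMn wB mulnDl => ew.
  have e1 : wdeg w k1 = (i * d)%N by lia.
  have e2 : wdeg w k2 = (j * d)%N by lia.
  case: i j ij2 {mp mq h1 h2 ew} e e1 e2 => [|[|[|i]]] // [|[|j]] //= _ e e1 e2.
  all: try by rewrite mulm0n; apply: wdeg_eq0.
  all: try by rewrite -e (@wdeg_eq0 k2) ?addm0.
  by rewrite mulm1n; apply: (@B2 k1 k2); rewrite ?e1 ?e2 ?mul1n // e addn1 mulmS mulm1n.
have eij : (B *+ (i + j) = B *+ i + B *+ j)%MM.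
  by apply/mnmP => l; rewrite mnmDE !mulmnE mulnDr.
rewrite /vcoef rmorphM eij; apply: mcoeffM_unique => l1 l2.
by rewrite -eij => e nz; apply: factor e.
Qed.

Definition rees_coef i (p : rees m) : K := vcoef (B *+ i) (val p)`_i.

Lemma rees_coef_is_zmod_morphism i : zmod_morphism (rees_coef i).
Proof. by move=> p q; rewrite /rees_coef rmorphB coefB raddfB. Qed.

HB.instance Definition _ i :=
  GRing.isZmodMorphism.Build (rees m) K (rees_coef i) (@rees_coef_is_zmod_morphism i).

Lemma rees_coefM i p q : (i <= 2)%N ->
  rees_coef i (p * q) = \sum_(j < i.+1) rees_coef j p * rees_coef (i - j) q.
Proof.
move=> i2; rewrite /rees_coef rmorphM coefM raddf_sum; apply: eq_bigr => j _.
have ij := subnKC (leq_ord j).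
rewrite -mcoeffM_pow ?ij //.
- by have /asboolP := valP p; apply.
- by have /asboolP := valP q; apply.
Qed.

Lemma rees_coef_gr_ker i p : p \in @gr_ker _ m -> rees_coef i p = 0.
Proof.
move=> /asboolP /(_ i) /ideal_exp_wdeg h; apply/eqP; apply: contraT => /h.
by rewrite wdegMn wB leq_pmul2r // ltnn.
Qed.

(* The representative is immaterial because [i * d], the weighted degree of
   [B *+ i], is too small for the support of m^(i+1). *)
Definition gr_coef i (x : gr m) : K := rees_coef i (repr x).

Lemma gr_coef_pi i (p : rees m) : gr_coef i (\pi_(gr m)%qT p) = rees_coef i p.
Proof.
apply/eqP; rewrite -subr_eq0 -raddfB; apply/eqP/rees_coef_gr_ker.
by rewrite Quotient.idealrBE reprK.
Qed.

Lemma gr_coef_is_zmod_morphism i : zmod_morphism (gr_coef i).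
Proof.
elim/quotW=> p; elim/quotW=> q.
by rewrite -(rmorphB \pi_(gr m)%qT) !gr_coef_pi raddfB.
Qed.

HB.instance Definition _ i :=
  GRing.isZmodMorphism.Build (gr m) K (gr_coef i) (@gr_coef_is_zmod_morphism i).

Lemma gr_coefM i (x y : gr m) : (i <= 2)%N ->
  gr_coef i (x * y) = \sum_(j < i.+1) gr_coef j x * gr_coef (i - j) y.
Proof.
elim/quotW: x => p; elim/quotW: y => q i2.
rewrite -(rmorphM \pi_(gr m)%qT) gr_coef_pi rees_coefM //.
by apply: eq_bigr => j _; rewrite !gr_coef_pi.
Qed.

Lemma gr_coef_comp i j (x : gr m) : gr_comp j x -> i != j -> gr_coef i x = 0.
Proof.
case=> a [p [vp ->]] ij; rewrite gr_coef_pi /rees_coef vp coefZ coefXn (negbTE ij).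
by rewrite mulr0 raddf0.
Qed.

Section Monomials.
Variables (k : 'X_{1..n}) (wk : wdeg w k = d).

Lemma monomial_in_veronese : 'X_[k] \in @veronese_pred K n w d.
Proof. by rewrite unfold_in msuppX /= wk dvdnn. Qed.

Definition vmon : V := Veronese monomial_in_veronese.

Lemma vmon_max : vmon \in m.
Proof. by rewrite unfold_in msuppX /= wk d_gt0. Qed.

Lemma monomial_in_rees : vmon *: 'X \in @rees_pred _ m.
Proof.
apply/asboolP => i; rewrite coefZ coefX; case: eqP => [->|_].
  exists 1%N, (fun=> vmon), (fun=> 1).
  by split=> // [_|]; rewrite ?vmon_max // big_ord1.
by rewrite mulr0; apply: ideal_exp0.
Qed.

Definition rmon : rees m := Rees monomial_in_rees.
Definition gmon : gr m := \pi_(gr m)%qT rmon.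

Lemma gmon_comp1 : gr_comp 1 gmon.
Proof. by exists vmon, rmon; rewrite expr1. Qed.

Lemma gr_coef1_gmon : gr_coef 1 gmon = (k == B)%:R.
Proof.
by rewrite gr_coef_pi /rees_coef coefZ coefX mulr1 mulm1n /vcoef mcoeffX.
Qed.

End Monomials.

Lemma monomial_relation_not_koszul (A C D : 'X_{1..n}) :
  wdeg w A = d -> wdeg w C = d -> wdeg w D = d ->
  (B + B + B = A + C + D)%MM -> A != B -> ~ veronese_koszul K w d.
Proof.
move=> wA wC wD rel AB.
apply: (@cubic_relation_not_koszul _ _ K gr_coef gr_coefM _
  (gmon wA) (gmon wB) (gmon wC) (gmon wD)).
- by move=> x x1; split; apply: gr_coef_comp x1 _.
- exact: gmon_comp1.
- exact: gmon_comp1.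
- exact: gmon_comp1.
- exact: gmon_comp1.
- rewrite -!(rmorphM \pi_(gr m)%qT); congr (\pi_(gr m)%qT _).
  have relV : vmon wB * vmon wB * vmon wB = vmon wA * vmon wC * vmon wD.
    by apply/val_inj; rewrite !rmorphM /= -!mpolyXD rel.
  (* Both sides are multiples of the cube of ['X], so it remains to compare their scalars. *)
  apply/val_inj; rewrite !rmorphM /= -!(scalerAl, scalerAr) !scalerA.
  by congr (_ *: _); rewrite mulrC relV mulrC.
- by apply: etrans (gr_coef1_gmon wA) _; rewrite (negbTE AB).
- by apply: etrans (gr_coef1_gmon wB) _; rewrite eqxx.
Qed.

End MonomialCoefficients.

(** * Reduction to arithmetic of the first three weights *)

Section ThreeVariables.
Variables (K : fieldType) (n w0 w1 w2 : nat) (w : (n.+3).-tuple nat).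
Hypotheses (w0_gt0 : 0 < w0) (w1_gt0 : 0 < w1) (w2_gt0 : 0 < w2).
Hypothesis take_w : take 3 w = [:: w0; w1; w2].
Hypothesis drop_w : forall x, x \in drop 3 w -> 3 * w2 < x.

Let w_cat : w = [:: w0; w1; w2] ++ drop 3 w :> seq nat.
Proof. by rewrite -take_w cat_take_drop. Qed.

Let wE (i : 'I_n.+3) : tnth w i = nth 0 ([:: w0; w1; w2] ++ drop 3 w) i.
Proof. by rewrite (tnth_nth 0) {1}w_cat. Qed.

Let w_large (i : 'I_n.+3) : 3 <= i -> 3 * w2 < tnth w i.
Proof.
move=> i3; rewrite wE nth_cat ifF; last by rewrite ltnNge i3.
apply/drop_w/mem_nth.
by rewrite size_drop (size_tuple w) /= ltn_sub2r ?(leq_ltn_trans i3).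
Qed.

Lemma weights_gt0 i : 0 < tnth w i.
Proof.
case: (leqP 3 i) => [/w_large|]; first by apply: leq_ltn_trans.
by rewrite wE; case: i => -[|[|[|i]]].
Qed.

(** The default of [nth] gives exponent 0 to every variable after the third. *)
Definition mnm3 a b c : 'X_{1..n.+3} := [multinom nth 0 [:: a; b; c] i | i < n.+3].

Lemma wdeg3 k : wdeg w k =
  k ord0 * w0 + (k (lift ord0 ord0) * w1 + (k (lift ord0 (lift ord0 ord0)) * w2 +
  \sum_(i < n) k (rshift 3 i) * tnth w (rshift 3 i))).
Proof.
rewrite /wdeg !big_ord_recl !wE /=; congr (_ + (_ + (_ + _))).
by apply: eq_bigr => i _; congr (k _ * tnth w _); apply: val_inj.
Qed.

Lemma wdeg_mnm3 a b c : wdeg w (mnm3 a b c) = a * w0 + b * w1 + c * w2.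
Proof.
rewrite wdeg3 !mnmE big1 /= ?addn0 ?addnA // => i _.
by rewrite mnmE /= nth_nil.
Qed.

(** A single later variable already has weight above [3 * w2]. *)
Lemma mnm3_of_wdeg k : wdeg w k = 3 * w2 -> exists a b c, k = mnm3 a b c.
Proof.
move=> wk; exists (k ord0), (k (lift ord0 ord0)), (k (lift ord0 (lift ord0 ord0))).
apply/mnmP => i; rewrite mnmE.
case: (leqP 3 i) => i3; last first.
  by case: i i3 => -[|[|[|i]]] //= i3 _; congr (k _); apply: val_inj.
rewrite nth_default //; apply/eqP; rewrite -leqn0 leqNgt; apply/negP => ki.
suff : wdeg w k <= 3 * w2 /\ tnth w i <= wdeg w k.
  by case=> _; rewrite wk leqNgt w_large.
split; first by rewrite wk.
by rewrite /wdeg (bigD1 i) //= (leq_trans _ (leq_addr _ _)) // leq_pmull.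
Qed.

Lemma mnm3D a b c a' b' c' :
  (mnm3 a b c + mnm3 a' b' c')%MM = mnm3 (a + a') (b + b') (c + c').
Proof.
apply/mnmP => i; rewrite mnmDE !mnmE.
by case: i => -[|[|[|i]]] //= _; rewrite !nth_nil.
Qed.

Lemma mnm3_inj a b c a' b' c' :
  mnm3 a b c = mnm3 a' b' c' -> [/\ a = a', b = b' & c = c'].
Proof.
move=> /mnmP e; have := (e ord0, e (lift ord0 ord0), e (lift ord0 (lift ord0 ord0))).
by rewrite !mnmE /= => -[[-> ->] ->].
Qed.

(** Here A = x_1^a1 x_2^b1, B = x_1^a2 x_2^b2 x_3, C = x_1^a3 x_2^b3 and D = x_3^3. When B^2 is
    split into two monomials of degree [3 * w2], the exponents of x_3 are 1 and 1, settled by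
    [uniqB], or 0 and 2; in the latter case x_1 and x_2 would have to supply weight [w2], against
    [noz2]. *)
Lemma three_weights_not_koszul a1 b1 a2 b2 a3 b3 :
  a1 * w0 + b1 * w1 = 3 * w2 -> a2 * w0 + b2 * w1 = 2 * w2 ->
  a3 * w0 + b3 * w1 = 3 * w2 ->
  a1 + a3 = 3 * a2 -> b1 + b3 = 3 * b2 ->
  (forall a b, a * w0 + b * w1 = 2 * w2 -> a = a2 /\ b = b2) ->
  (forall a b, a * w0 + b * w1 <> w2) ->
  ~ veronese_koszul K w (3 * w2).
Proof.
move=> wA wB wC rela relb uniqB noz2.
apply: (@monomial_relation_not_koszul K _ w _ weights_gt0 (mnm3 a2 b2 1) _ _ _
  (mnm3 a1 b1 0) (mnm3 a3 b3 0) (mnm3 0 0 3)).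
- by rewrite muln_gt0.
- by rewrite wdeg_mnm3; lia.
- move=> k1 k2 e12 wk1 wk2.
  have [a [b [c e1]]] := mnm3_of_wdeg wk1.
  have [a' [b' [c' e2]]] := mnm3_of_wdeg wk2.
  move: e12 wk1 wk2; rewrite e1 e2 !wdeg_mnm3 !mnm3D => /mnm3_inj[_ _ c2] wk1 wk2.
  case: c c2 wk1 {e1 e2} => [|[|[|c]]] //= c2 wk1.
  + by case: (noz2 a' b'); lia.
  + by have [-> ->] : a = a2 /\ b = b2 by apply: uniqB; lia.
  + by case: (noz2 a b); lia.
- by rewrite wdeg_mnm3; lia.
- by rewrite wdeg_mnm3; lia.
- by rewrite wdeg_mnm3; lia.
- by rewrite !mnm3D; congr mnm3; lia.
- by apply/eqP => /mnm3_inj[].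
Qed.

End ThreeVariables.

(** * The two families *)

Theorem proposition4p3 (K : fieldType) (n : nat) (hn : (3 <= n)%N) :
  (forall (k : nat) (w : n.-tuple nat),
     (1 <= k)%N ->
     take 3 w = [:: 3; 3 * k + 1; 3 * k + 2]%N ->
     (forall x, x \in drop 3 w -> (3 * (3 * k + 2) < x)%N) ->
     ~ veronese_koszul K w (3 * (3 * k + 2))%N)
  /\
  (forall (f : nat) (w : n.-tuple nat),
     (2 <= f)%N ->
     take 3 w = [:: f + 1; f + 2; f ^ 2 + f - 1]%N ->
     (forall x, x \in drop 3 w -> (3 * (f ^ 2 + f - 1) < x)%N) ->
     ~ veronese_koszul K w (3 * (f ^ 2 + f - 1))%N).
Proof.
case: n hn => [|[|[|n]]] // _; split.
  move=> k w k1 take_w drop_w.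
  (* The relation is (x_1^(k+1) x_2 x_3)^3 = x_1^(3k+2) * x_1 x_2^3 * x_3^3. *)
  apply: (@three_weights_not_koszul K n _ _ _ w _ _ _ take_w drop_w
    (3 * k + 2) 0 k.+1 1 1 3); try lia.
  (* Modulo 3 the equation says that [b] is 1, and size bounds [b] by 2. *)
  - move=> a b e.
    have b3 : b < 3 by nia.
    by case: b b3 e => [|[|[|b]]] //= _ e; lia.
  (* Now [b] is 2 modulo 3, but size allows only 0 and 1. *)
  - move=> a b e.
    have b3 : b < 2 by nia.
    by case: b b3 e => [|[|b]] //= _ e; lia.
move=> [|[|h]] // w _.
(* Writing f = h + 2 removes the truncated subtraction. *)
have -> : h.+2 ^ 2 + h.+2 - 1 = h * h + 5 * h + 5 by nia.
rewrite !addSn => take_w drop_w.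
(* In terms of f: A = x_1^(2f+1) x_2^(f-2), B = x_1^f x_2^(f-1) x_3 and C = x_1^(f-1) x_2^(2f-1). *)
apply: (@three_weights_not_koszul K n _ _ _ w _ _ _ take_w drop_w
  (2 * h + 5) h (h + 2) (h + 1) (h + 1) (2 * h + 3)); try nia.
- move=> a b e.
  (* The weight lies between [(a + b) * (h + 3)] and [(a + b) * (h + 4)], which leaves one value of
     [a + b]; the excess over the lower bound is [b]. *)
  have s : a + b = 2 * h + 3 by nia.
  by nia.
- move=> a b e.
  (* The third weight lies strictly between [(h + 1) * (h + 4)] and [(h + 2) * (h + 3)], which
     differ from it by 1. *)
  have [s|s] := leqP (a + b) (h + 1); nia.
Qed.
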